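(* Let $k,r\geq 2$ be fixed integers. Then $f_r(n,C_{2k})=\Omega\left(n^{\frac{r}{r-1}\cdot\frac{k-1}{k}}\right)$. Equivalently, if $K_n$ is properly edge-coloured with $o\left(n^{\frac{r}{r-1}\cdot\frac{k-1}{k}}\right)$ colours (as $n\to\infty$), then for all sufficiently large $n$ it contains $r$ pairwise vertex-disjoint, pairwise colour-isomorphic copies of $C_{2k}$.
   Context: Two subgraphs of an edge-coloured graph are colour-isomorphic if there is a graph isomorphism between them that preserves edge colours. For an integer $r\geq 2$ and a graph $H$, $f_r(n,H)$ is the smallest number $c$ such that there is a proper edge-colouring of the complete graph $K_n$ with $c$ colours containing no $r$ pairwise vertex-disjoint, pairwise colour-isomorphic copies of $H$. An edge-colouring is proper if edges sharing a vertex get different colours. *)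

(* Defs.v *)
From Stdlib Require Import Reals.
From mathcomp Require Import all_boot all_fingroup.
Set Implicit Arguments. Unset Strict Implicit. Unset Printing Implicit Defensive.

Definition cycle_graph (m : nat) : rel 'I_m :=
  fun i j => (val j == (val i).+1 %% m) || (val i == (val j).+1 %% m).

Definition proper_colouring (n c : nat) (col : 'I_n -> 'I_n -> 'I_c) : Prop :=
  (forall u v, col u v = col v u) /\
  (forall u v w, u != v -> u != w -> v != w -> col u v != col u w).

Definition is_copy (m n : nat) (phi : 'I_m -> 'I_n) : Prop := injective phi.

(* Two copies phi, psi of H are colour-isomorphic: there is an isomorphism of
   the image subgraphs preserving colours; any such isomorphism has the form
   psi o tau o phi^{-1} with tau an automorphism of H. *)
Definition colour_iso (m n c : nat) (H : rel 'I_m) (col : 'I_n -> 'I_n -> 'I_c)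
    (phi psi : 'I_m -> 'I_n) : Prop :=
  exists tau : {perm 'I_m},
    (forall u v, H u v = H (tau u) (tau v)) /\
    (forall u v, H u v -> col (phi u) (phi v) = col (psi (tau u)) (psi (tau v))).

Definition has_r_disjoint_iso_copies (r m n c : nat) (H : rel 'I_m)
    (col : 'I_n -> 'I_n -> 'I_c) : Prop :=
  exists F : 'I_r -> 'I_m -> 'I_n,
    (forall j, is_copy (F j)) /\
    (forall j j', j != j' -> forall u v, F j u != F j' v) /\
    (forall j j', j != j' -> colour_iso H col (F j) (F j')).

Definition expo (r k : nat) : R :=
  Rmult (Rdiv (INR r) (Rminus (INR r) 1)) (Rdiv (Rminus (INR k) 1) (INR k)).

(* Main.v *)
(* Consider the graph whose vertices are the injective r-tuples of vertices of
   K_n, two tuples being adjacent when all r coordinate edges have the same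
   colour. A cycle of length 2k in it whose tuples are pairwise disjoint is the
   required family of copies of C_2k. Properness of the colouring makes the
   number of neighbours of a tuple that meet a given tuple at most r^2, whatever
   the degrees, while the assumption on the number of colours makes the average
   degree large compared with N^(1/k), where N <= n^r is the number of tuples.

   In a graph of minimum degree delta, let W_j be the sum over all closed walks
   of length 2j of the product of the inverse degrees of their vertices, i.e.
   the trace of the 2j-th power of the random walk operator. Then W_0 = N,
   W_k >= 1 and W is log-convex. The closed walks of length 2k in which two
   vertices clash have weight at most W_k / 2 + O(W_(k-1) / delta). If they were
   all of the closed walks, then W_k <= O(W_(k-1) / delta), hence
   1 <= W_k <= O(1 / delta)^k N by log-convexity, which is false when
   delta^k is large compared with N. *)

Require Import Defs.
From Stdlib Require Import Reals Lra.
From mathcomp Require Import all_boot all_fingroup all_order all_algebra zify.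
Set Implicit Arguments. Unset Strict Implicit. Unset Printing Implicit Defensive.

(** * Clearing the real exponent: reduction to an inequality between natural numbers *)

Lemma INR_muln a b : INR (a * b) = Rmult (INR a) (INR b).
Proof. by rewrite -multE mult_INR. Qed.

Lemma INR_expn a b : INR (a ^ b) = pow (INR a) b.
Proof. by elim: b => [|b IH] //; rewrite expnS INR_muln IH. Qed.

(** The power [(r - 1) * k] clears both denominators of [expo r k] and leaves the integer exponent
    [r * (k - 1)]. *)
Lemma pow_Rpower_expo (n r k : nat) : 0 < n -> 1 < r -> 0 < k ->
  pow (Rpower (INR n) (expo r k)) (r.-1 * k) = INR (n ^ (r * k.-1)).
Proof.
move=> n0 r1 k0.
have n0' : Rlt 0 (INR n) by apply: lt_0_INR; apply/ltP.
rewrite INR_expn -!Rpower_pow //; last exact: exp_pos.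
rewrite Rpower_mult; congr Rpower.
case: r r1 => // r r1; case: k k0 => // k _.
have r0 : INR r <> R0 by apply: not_0_INR; lia.
have {}k0 : INR k.+1 <> R0 by apply: not_0_INR.
rewrite /expo !INR_muln [r.+1.-1]/= [k.+1.-1]/=.
by move: k0; rewrite !S_INR => k0; field; split=> // h; apply: r0; lra.
Qed.

Lemma lt_expn_of_lt_Rpower_expo (Q r k : nat) : 0 < Q -> 1 < r -> 0 < k ->
  exists2 eps : R, Rlt 0 eps & forall n c : nat, 0 < n ->
    Rlt (INR c) (Rmult eps (Rpower (INR n) (expo r k))) ->
    Q * c ^ (r.-1 * k) < n ^ (r * k.-1).
Proof.
move=> Q0 r1 k0; pose q := INR Q.
have q1 : Rle 1 q by rewrite -[IZR 1]/(INR 1); apply: le_INR; apply/leP.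
(* As [eps <= 1] and the exponent [(r - 1) * k] is positive, the power of [eps] is at most [eps], so
   its product with [Q] is at most 1/2. *)
pose eps : R := Rinv (Rmult 2 q).
have eps0 : Rlt 0 eps by apply: Rinv_0_lt_compat; lra.
have eps1 : Rle eps 1 by rewrite -Rinv_1; apply: Rinv_le_contravar; lra.
have epsq : Rmult q eps = Rinv 2 by rewrite /eps; field; lra.
exists eps => // n c n0 few; apply/ltP; apply: INR_lt.
rewrite INR_muln INR_expn -pow_Rpower_expo // -/q.
set P := Rpower _ _ in few *.
have P0 : Rlt 0 P by exact: exp_pos.
have [L ->] : exists L, r.-1 * k = L.+1 by exists (r.-1 * k).-1; nia.
have PL : Rlt 0 (pow P L.+1) by exact: pow_lt.
have cL : Rle (pow (INR c) L.+1) (pow (Rmult eps P) L.+1).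
  by apply: pow_incr; split; [exact: pos_INR | exact: Rlt_le].
have eL : Rle (pow eps L) 1.
  by rewrite -(pow1 L); apply: pow_incr; split=> //; exact: Rlt_le.
rewrite Rpow_mult_distr in cL.
apply: Rle_lt_trans (Rmult_le_compat_l q _ _ _ cL) _; first by lra.
have -> : Rmult q (Rmult (pow eps L.+1) (pow P L.+1)) =
  Rmult (Rmult (Rmult q eps) (pow eps L)) (pow P L.+1) by rewrite [pow eps _]/=; ring.
by rewrite epsq; nra.
Qed.

(* Only from here on: these imports shadow the tactics for the type R used above. *)
From mathcomp Require Import ring lra.

(** * Return weights of the random walk on a finite graph *)

Section ClosedWalks.
Import Order.TTheory GRing.Theory Num.Theory.
Local Open Scope ring_scope.

(** Lagrange's identity: the defect is half of a double sum of weighted squares. *)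
Lemma weighted_Cauchy_Schwarz (F : realFieldType) (I : finType) (w a b : I -> F) :
  (forall i, 0 <= w i) ->
  (\sum_i w i * (a i * b i)) ^+ 2 <=
  (\sum_i w i * a i ^+ 2) * (\sum_i w i * b i ^+ 2).
Proof.
move=> w0.
have h : 0 <= \sum_i \sum_j w i * w j * (a i * b j - a j * b i) ^+ 2.
  apply: sumr_ge0 => i _; apply: sumr_ge0 => j _.
  by rewrite mulr_ge0 ?sqr_ge0 ?mulr_ge0.
have E : \sum_i \sum_j w i * w j * (a i * b j - a j * b i) ^+ 2 =
  (\sum_i w i * a i ^+ 2) * (\sum_i w i * b i ^+ 2) +
  (\sum_i w i * b i ^+ 2) * (\sum_i w i * a i ^+ 2) -
  2 * (\sum_i w i * (a i * b i)) ^+ 2.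
  rewrite expr2 !big_distrlr mulr_sumr -big_split -sumrB; apply: eq_bigr => i _.
  rewrite mulr_sumr -big_split -sumrB; apply: eq_bigr => j _ /=; ring.
by rewrite E in h; lra.
Qed.

Variables (F : realFieldType) (V : finType) (e : rel V).
Hypothesis e_sym : symmetric e.

Definition deg x := #|[pred y | e x y]|.
Local Notation dg x := ((deg x)%:R : F).

Hypothesis deg_gt0 : forall x, (0 < deg x)%N.

Definition step x y : F := (e x y)%:R / dg x.

Fixpoint walk j x y : F :=
  if j is j'.+1 then \sum_z step x z * walk j' z y else (x == y)%:R.

Lemma dg_gt0 x : 0 < dg x. Proof. by rewrite ltr0n. Qed.
Lemma dg_neq0 x : dg x != 0. Proof. by rewrite gt_eqF ?dg_gt0. Qed.
Lemma dg_sum x : dg x = \sum_y (e x y)%:R.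
Proof.
rewrite /deg -sum1_card natr_sum big_mkcond; apply: eq_bigr => y _ /=.
by rewrite inE; case: (e x y).
Qed.
Lemma step_ge0 x y : 0 <= step x y. Proof. by rewrite divr_ge0 ?ler0n. Qed.

Lemma walk_ge0 j x y : 0 <= walk j x y.
Proof.
elim: j x y => [|j IH] x y /=; first exact: ler0n.
by apply: sumr_ge0 => z _; rewrite mulr_ge0 ?step_ge0.
Qed.

Lemma walkD i j x y : walk (i + j) x y = \sum_z walk i x z * walk j z y.
Proof.
elim: i x y => [|i IH] x y /=.
  rewrite (bigD1 x) //= eqxx mul1r big1 ?addr0 // => z.
  by rewrite eq_sym => /negPf ->; rewrite mul0r.
under eq_bigr => z _ do rewrite IH mulr_sumr.
rewrite exchange_big; apply: eq_bigr => z _ /=.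
by rewrite mulr_suml; apply: eq_bigr => u _; rewrite mulrA.
Qed.

Lemma walk1 x y : walk 1 x y = step x y.
Proof.
rewrite /= (bigD1 y) //= eqxx mulr1 big1 ?addr0 // => z /negPf ->.
by rewrite mulr0.
Qed.

Lemma walkSr j x y : walk j.+1 x y = \sum_z walk j x z * step z y.
Proof. by rewrite -addn1 walkD; under eq_bigr => z _ do rewrite walk1. Qed.

Lemma step_rev x y : dg x * step x y = (e x y)%:R.
Proof. by rewrite mulrCA divff ?dg_neq0 // mulr1. Qed.

(** Detailed balance: the walk is reversible with respect to the degrees because [e] is
    symmetric. *)
Lemma walk_rev j x y : dg x * walk j x y = dg y * walk j y x.
Proof.
elim: j x y => [|j IH] x y.
  by rewrite /= [y == x]eq_sym; case: eqP => [->|]; rewrite ?mulr0.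
rewrite walkSr /= !mulr_sumr; apply: eq_bigr => z _.
by rewrite mulrA IH mulrA step_rev e_sym -step_rev; ring.
Qed.

Lemma walk_sum1 j x : \sum_y walk j x y = 1.
Proof.
elim: j x => [|j IH] x /=.
  rewrite (bigD1 x) //= eqxx big1 ?addr0 // => z.
  by rewrite eq_sym => /negPf ->.
rewrite exchange_big /=; under eq_bigr => z _ do rewrite -mulr_sumr IH mulr1.
by rewrite -mulr_suml -dg_sum divff ?dg_neq0.
Qed.

(** The trace of the [j]-th power of the transition matrix; the W_j of the overview is
    [ret (j + j)]. *)
Definition ret j : F := \sum_x walk j x x.

Lemma ret_split i j : ret (i + j) = \sum_x \sum_y walk i x y * walk j y x.
Proof. by apply: eq_bigr => x _; rewrite walkD. Qed.

(** The kernel of the walk with respect to the degree measure. Reversibility makes it symmetric, so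
    that traces become inner products of kernels. *)
Definition symwalk j x y : F := walk j x y / dg y.

Lemma symwalkC j x y : symwalk j x y = symwalk j y x.
Proof.
apply: (mulfI (dg_neq0 x)); apply: (mulfI (dg_neq0 y)).
by rewrite /symwalk mulrA mulrC !mulrA mulfVK ?dg_neq0 // mulrC walk_rev; field;
  rewrite dg_neq0.
Qed.

Lemma ret_sym i j :
  ret (i + j) = \sum_(u : V * V) dg u.1 * dg u.2 * (symwalk i u.1 u.2 * symwalk j u.1 u.2).
Proof.
rewrite ret_split pair_bigA; apply: eq_bigr => -[x y] _ /=.
by rewrite [symwalk j x y]symwalkC /symwalk; field; rewrite !dg_neq0.
Qed.

(** Cauchy-Schwarz for the kernels of [j] and [j + 2] steps, whose inner product is the trace of
    [2 * j + 2] steps. *)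
Lemma ret_log_convex j : ret (j.+1 + j.+1) ^+ 2 <= ret (j + j) * ret (j.+2 + j.+2).
Proof.
have -> : (j.+1 + j.+1 = j + j.+2)%N by lia.
rewrite !ret_sym.
have := @weighted_Cauchy_Schwarz _ _ (fun u : V * V => dg u.1 * dg u.2)
  (fun u => symwalk j u.1 u.2) (fun u => symwalk j.+2 u.1 u.2).
by apply=> u; rewrite mulr_ge0 ?ler0n.
Qed.

(** Cauchy-Schwarz for the [j]-step kernel against the constant 1: since rows of [walk] sum to 1,
    the inner product is the sum of the degrees, and the constant has that same norm. *)
Lemma ret_even_ge1 j : (0 < #|V|)%N -> 1 <= ret (j + j).
Proof.
move=> /card_gt0P[x0 _].
have := @weighted_Cauchy_Schwarz _ _ (fun u : V * V => dg u.1 * dg u.2)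
  (fun u => symwalk j u.1 u.2) (fun=> 1).
have -> : \sum_(u : V * V) dg u.1 * dg u.2 * (symwalk j u.1 u.2 * 1) = \sum_x dg x.
  rewrite -(pair_bigA _ (fun x y => dg x * dg y * (symwalk j x y * 1))) /=.
  apply: eq_bigr => x _; transitivity (dg x * \sum_y walk j x y); last by rewrite walk_sum1 mulr1.
  rewrite mulr_sumr.
  by apply: eq_bigr => y _; rewrite /symwalk; field; rewrite dg_neq0.
have -> : \sum_(u : V * V) dg u.1 * dg u.2 * 1 ^+ 2 = (\sum_x dg x) ^+ 2.
  rewrite -(pair_bigA _ (fun x y => dg x * dg y * 1 ^+ 2)) /= [RHS]expr2 big_distrlr /=.
  by apply: eq_bigr => x _; apply: eq_bigr => y _; rewrite expr1n mulr1.
rewrite ret_sym => h; have {h}/h : forall u : V * V, 0 <= dg u.1 * dg u.2.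
  by move=> u; rewrite mulr_ge0 ?ler0n.
have s0 : 0 < (\sum_x dg x) ^+ 2.
  rewrite exprn_gt0 // (bigD1 x0) //= ltr_wpDr ?dg_gt0 //.
  by apply: sumr_ge0 => x _; exact: ler0n.
by rewrite -{1}[_ ^+ 2]mul1r ler_pM2r.
Qed.

Lemma ret0 : ret 0 = #|V|%:R.
Proof.
by rewrite -sum1_card natr_sum; apply: eq_bigr => x _; rewrite /= eqxx.
Qed.

(** By log-convexity the ratios of consecutive even traces increase, so a bound on the last ratio
    holds for all of them; their product runs from [ret 0] up to a trace that is at least 1. *)
Lemma ret_geometric k t : (0 < #|V|)%N -> 0 <= t ->
  ret (k.+1 + k.+1) <= t * ret (k + k) -> 1 <= t ^+ k.+1 * #|V|%:R.
Proof.
move=> V0 t0 h.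
have pos j : 0 < ret (j + j) by exact: lt_le_trans (ret_even_ge1 j V0).
have down : forall i j, (i + j = k)%N -> ret (j.+1 + j.+1) <= t * ret (j + j).
  elim=> [|i IH] j E; first by rewrite -[j]/((0 + j)%N) E.
  have {}IH := IH j.+1 (ltac:(lia)).
  rewrite -(ler_pM2r (pos j.+1)) -expr2; apply: le_trans (ret_log_convex j) _.
  by rewrite [t * _]mulrC -mulrA ler_pM2l ?pos.
have up : forall j, (j <= k.+1)%N -> ret (j + j) <= t ^+ j * #|V|%:R.
  elim=> [|j IH] jk; first by rewrite mul1r ret0.
  apply: le_trans (down (k - j)%N j (ltac:(lia))) _.
  by rewrite exprS -mulrA ler_wpM2l // IH // ltnW.
exact: le_trans (ret_even_ge1 _ V0) (up _ _).
Qed.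

(** * Weights of individual walks and sums over vertex sequences *)

Fixpoint pathw x s : F :=
  if s is y :: s' then step x y * pathw y s' else 1.

Definition cyclew c : F := if c is x :: s then pathw x (rcons s x) else 1.

Lemma pathw_ge0 x s : 0 <= pathw x s.
Proof. by elim: s x => //= y s IH x; rewrite mulr_ge0 ?step_ge0. Qed.

Lemma cyclew_ge0 c : 0 <= cyclew c.
Proof. by case: c => //= x s; exact: pathw_ge0. Qed.

Lemma pathw_path x s : pathw x s != 0 -> path e x s.
Proof.
elim: s x => //= y s IH x; rewrite mulf_eq0 negb_or => /andP[h /IH ->].
by move: h; rewrite /step; case: (e x y); rewrite ?mul0r ?eqxx.
Qed.

Lemma pathw_cat x s t : pathw x (s ++ t) = pathw x s * pathw (last x s) t.
Proof. by elim: s x => [|y s IH] x /=; rewrite ?mul1r // IH mulrA. Qed.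

Lemma pathw_rcons x s y : pathw x (rcons s y) = pathw x s * step (last x s) y.
Proof. by rewrite -cats1 pathw_cat /= mulr1. Qed.

Lemma cyclew_rot i c : cyclew (rot i c) = cyclew c.
Proof.
have rot1 s : cyclew (rot 1 s) = cyclew s.
  case: s => // x [|y s]; rewrite rot1_cons // [LHS]/= [RHS]/= !pathw_rcons.
  by rewrite last_rcons; ring.
elim: i => [|i IH]; first by rewrite rot0.
have [ic|ci] := ltnP i (size c); last by rewrite rot_oversize // ltnW.
by rewrite -add1n rotD ?rot1 // add1n.
Qed.

(** Recursion on the length, rather than a sum over tuples, lets a closed walk be cut into pieces
    without dependent types. *)
Fixpoint seqsum n (G : seq V -> F) : F :=
  if n is n'.+1 then \sum_x seqsum n' (fun s => G (x :: s)) else G [::].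

Lemma eq_seqsum n G H :
  (forall s, size s = n -> G s = H s) -> seqsum n G = seqsum n H.
Proof.
elim: n G H => [|n IH] G H h /=; first exact: h.
by apply: eq_bigr => x _; apply: IH => s sz; apply: h; rewrite /= sz.
Qed.

Lemma ler_seqsum n G H :
  (forall s, size s = n -> G s <= H s) -> seqsum n G <= seqsum n H.
Proof.
elim: n G H => [|n IH] G H h /=; first exact: h.
by apply: ler_sum => x _; apply: IH => s sz; apply: h; rewrite /= sz.
Qed.

Lemma seqsum_sum (I : Type) (r : seq I) (P : pred I) n (G : I -> seq V -> F) :
  seqsum n (fun s => \sum_(i <- r | P i) G i s) = \sum_(i <- r | P i) seqsum n (G i).
Proof.
elim: n G => [|n IH] G //=.
by under eq_bigr => x _ do rewrite IH; rewrite exchange_big.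
Qed.

Lemma seqsumZ n a G : seqsum n (fun s => a * G s) = a * seqsum n G.
Proof.
elim: n G => [|n IH] G //=.
by under eq_bigr => x _ do rewrite IH; rewrite mulr_sumr.
Qed.

Lemma seqsum_add n G H : seqsum n (fun s => G s + H s) = seqsum n G + seqsum n H.
Proof.
elim: n G H => [|n IH] G H //=.
by under eq_bigr => x _ do rewrite IH; rewrite big_split.
Qed.

Lemma seqsum_cat m n G :
  seqsum (m + n) G = seqsum m (fun s => seqsum n (fun t => G (s ++ t))).
Proof. by elim: m G => [|m IH] G //=; apply: eq_bigr => x _; exact: IH. Qed.

Lemma seqsum_rot i n G : seqsum n (fun s => G (rot i s)) = seqsum n G.
Proof.
(* The same sum with the last entry outermost; comparing the two orders gives rotation by one. *)
have rc m H : seqsum m.+1 H = \sum_x seqsum m (fun s => H (rcons s x)).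
  elim: m H => [|m IH] H //.
  transitivity (\sum_x seqsum m.+1 (fun s => H (x :: s))) => //.
  under eq_bigr => x _ do rewrite IH.
  by rewrite exchange_big; apply: eq_bigr.
have rot1 m H : seqsum m (fun s => H (rot 1 s)) = seqsum m H.
  case: m => [|m] //; rewrite [RHS]rc.
  apply: eq_bigr => x _; apply: eq_seqsum => s _; congr H; exact: rot1_cons.
elim: i G => [|i IH] G; first by apply: eq_seqsum => s _; rewrite rot0.
have [lt_in|le_ni] := ltnP i n; last first.
  by apply: eq_seqsum => s sz; rewrite rot_oversize // sz ltnW.
rewrite -[RHS]rot1 -[RHS]IH; apply: eq_seqsum => s sz.
by rewrite -rotD ?add1n // sz.
Qed.

Lemma seqsum_walk n x (h : V -> F) :
  seqsum n (fun s => pathw x s * h (last x s)) = \sum_y walk n x y * h y.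
Proof.
elim: n x => [|n IH] x /=.
  rewrite (bigD1 x) //= eqxx big1 ?addr0 // => z.
  by rewrite eq_sym => /negPf ->; rewrite mul0r.
under eq_bigr => y _.
  under eq_seqsum => s _ do rewrite -mulrA.
  rewrite seqsumZ IH mulr_sumr; over.
rewrite exchange_big; apply: eq_bigr => z _ /=.
by rewrite mulr_suml; apply: eq_bigr => y _; rewrite mulrA.
Qed.

Lemma seqsum_cyclew n : seqsum n.+1 cyclew = ret n.+1.
Proof.
apply: eq_bigr => x _; rewrite walkSr -seqsum_walk.
by apply: eq_seqsum => s _; rewrite /= pathw_rcons.
Qed.

(** * Clashing closed walks and the existence of a clash-free cycle *)

Variables (sim : rel V) (s delta : nat).
Hypothesis sim_sym : symmetric sim.
Hypothesis sim_nbr : forall u v, (#|[pred w | e v w && sim u w]| <= s)%N.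
Hypothesis delta_gt0 : (0 < delta)%N.
Hypothesis delta_deg : forall x, (delta <= deg x)%N.

(** The index [l] counts in the tail, so positions 0 and [l + 1] of the cycle are compared. *)
Definition clash l c := if c is x :: t then sim x (nth x t l) else false.

(** The clash concerns only [x :: y :: t], so the other [k] vertices sum out to a walk of [k + 1]
    steps back to [x]. The inverse degree of [x] from the edge [x y] turns it into [symwalk]. *)
Lemma clash_weight_split k l : (l < k.+1)%N ->
  seqsum (k.+1 + k.+1) (fun c => (clash l c)%:R * cyclew c) =
  \sum_x \sum_y seqsum k (fun t =>
    (sim x (nth x (y :: t) l))%:R * (e x y)%:R * pathw y t * symwalk k.+1 (last y t) x).
Proof.
move=> lk; rewrite addnS [LHS]/=; apply: eq_bigr => x _; apply: eq_bigr => y _.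
rewrite seqsum_cat; apply: eq_seqsum => t sz.
transitivity (seqsum k (fun r => ((sim x (nth x (y :: t) l))%:R * step x y * pathw y t) *
   (pathw (last y t) r * step (last (last y t) r) x))).
  apply: eq_seqsum => r _; rewrite -cat_cons nth_cat /= sz lk.
  by rewrite rcons_cat pathw_cat pathw_rcons; ring.
rewrite seqsumZ (seqsum_walk _ _ (fun z => step z x)) -walkSr /step /symwalk; field.
exact: dg_neq0.
Qed.

(* Compare the walk of length k closing the cycle with the one of length k - 1
   that avoids the edge xy. Where [symwalk k.+1 x z <= C * symwalk k y z], at
   most [s] choices of [x] clash once the short walk is fixed; elsewhere one
   drops the clash and bounds the short walk by the long one. The weights 1/deg
   make the number of choices of [y] irrelevant, so no bound on the maximum
   degree is needed. *)
Lemma clash_weight_le k l (C : nat) : (l < k.+1)%N -> (0 < C)%N ->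
  seqsum (k.+1 + k.+1) (fun c => (clash l c)%:R * cyclew c) <=
  ret (k.+1 + k.+1) / C%:R + C%:R * s%:R / delta%:R * ret (k + k).
Proof.
move=> lk C0; rewrite clash_weight_split //.
have C0' : 0 < C%:R :> F by rewrite ltr0n.
have d0 : 0 < delta%:R :> F by rewrite ltr0n.
set a := symwalk k; set b := symwalk k.+1.
have a0 y z : 0 <= a y z by rewrite divr_ge0 ?walk_ge0 ?ler0n.
have b0 y z : 0 <= b y z by rewrite divr_ge0 ?walk_ge0 ?ler0n.
pose h x y z := if C%:R * a y z < b x z then b x z else 0.
apply: (@le_trans _ _ (\sum_y seqsum k (fun t => pathw y t * (C%:R * s%:R * a y (last y t))) +
  \sum_x \sum_y seqsum k (fun t => pathw y t * ((e x y)%:R * h x y (last y t))))).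
  apply: (@le_trans _ _ (\sum_y seqsum k (fun t => \sum_x
     (sim x (nth x (y :: t) l))%:R * (e x y)%:R * (pathw y t * (C%:R * a y (last y t)))) +
    \sum_x \sum_y seqsum k (fun t => pathw y t * ((e x y)%:R * h x y (last y t))))).
    under [X in _ <= X + _]eq_bigr => y _ do rewrite seqsum_sum.
    rewrite [X in _ <= X + _]exchange_big -big_split; apply: ler_sum => x _ /=.
    rewrite -big_split; apply: ler_sum => y _ /=.
    rewrite -seqsum_add; apply: ler_seqsum => t _.
    rewrite /b symwalkC -/b /h.
    set z := last y t; set w := pathw y t; have w0 : 0 <= w := pathw_ge0 _ _.
    have wa0 : 0 <= w * (C%:R * a y z) := mulr_ge0 w0 (mulr_ge0 (ltW C0') (a0 y z)).
    have wb0 : 0 <= w * b x z := mulr_ge0 w0 (b0 x z).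
    case: ltP => [_|/(ler_wpM2l w0) le_ba].
      case: (sim _ _); case: (e x y); rewrite ?mul1r ?mul0r ?mulr0; lra.
    case: (sim _ _); case: (e x y); rewrite ?mul1r ?mul0r ?mulr0; lra.
  rewrite lerD2r; apply: ler_sum => y _; apply: ler_seqsum => t sz.
  rewrite -mulr_suml; set w := pathw y t; set z := last y t.
  have -> : w * (C%:R * s%:R * a y z) = s%:R * (w * (C%:R * a y z)) by ring.
  rewrite ler_wpM2r //; first exact: mulr_ge0 (pathw_ge0 _ _) (mulr_ge0 (ltW C0') (a0 y z)).
  set u := nth y (y :: t) l.
  apply: le_trans (_ : #|[pred w | e y w && sim u w]|%:R <= _); last by rewrite ler_nat sim_nbr.
  rewrite -sum1_card natr_sum [leRHS]big_mkcond; apply: ler_sum => x _.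
  rewrite inE /= (set_nth_default y) /= ?sz // -/u sim_sym e_sym andbC.
  by case: (sim u x); case: (e y x); rewrite ?mul1r ?mul0r.
rewrite addrC lerD //.
  rewrite ler_pdivlMr // mulr_suml ret_split; apply: ler_sum => x _.
  under eq_bigr => y _ do rewrite (seqsum_walk _ _ (fun z => (e x y)%:R * h x y z)).
  rewrite exchange_big mulr_suml; apply: ler_sum => z _ /=.
  have -> : walk k.+1 x z * walk k.+1 z x = dg x * (dg z * b x z ^+ 2).
    rewrite expr2 {2}/b symwalkC /b /symwalk; field.
    by rewrite !dg_neq0.
  rewrite dg_sum !mulr_suml; apply: ler_sum => y _.
  have -> : walk k y z = dg z * a y z by rewrite mulrC divfK ?dg_neq0.
  rewrite /h; case: (e x y); last by rewrite !mul0r mulr0 mul0r.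
  case: ltP => [lt_ab|_]; rewrite !mul1r; last first.
    by rewrite mulr0 mul0r mulr_ge0 ?ler0n ?sqr_ge0.
  have -> : dg z * a y z * b x z * C%:R = dg z * (C%:R * a y z * b x z) by ring.
  by rewrite ler_wpM2l ?ler0n // expr2 ler_wpM2r ?b0 // ltW.
rewrite ret_split mulr_sumr; apply: ler_sum => y _.
rewrite (seqsum_walk _ _ (fun z => C%:R * s%:R * a y z)) mulr_sumr.
apply: ler_sum => z _; rewrite /a symwalkC /symwalk.
have -> : C%:R * s%:R / delta%:R * (walk k y z * walk k z y) =
  walk k y z * (C%:R * s%:R * (walk k z y / delta%:R)) by ring.
rewrite ler_wpM2l ?walk_ge0 // ler_wpM2l ?mulr_ge0 ?ler0n //.
by rewrite ler_wpM2l ?walk_ge0 // lef_pV2 ?posrE ?dg_gt0 // ler_nat.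
Qed.

Lemma seqsum_gt0 n G : 0 < seqsum n G -> exists2 c, size c = n & 0 < G c.
Proof.
elim: n G => [|n IH] G /= G0; first by exists [::].
case: (pickP (fun x => 0 < seqsum n (fun c => G (x :: c)))) => [x /IH[c sz Gc]|np].
  by exists (x :: c); rewrite //= sz.
suff : \sum_x seqsum n (fun c => G (x :: c)) <= 0 by rewrite leNgt G0.
by apply: sumr_le0 => x _; rewrite leNgt np.
Qed.

(* Among two clashing positions of a closed 2k-walk, one follows the other
   within at most k steps, so rotating brings the pair to (0, l + 1) with l < k. *)
Lemma clash_rot k c : size c = (k + k)%N -> ~~ pairwise (fun x y => ~~ sim x y) c ->
  exists i : 'I_(k + k), exists l : 'I_k, clash l (rot i c).
Proof.
move=> sz npw; have [x0 _] : exists x : V, true.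
  by case: c npw {sz} => // x c _; exists x.
have {npw} : ~ {in gtn (size c) &, {homo nth x0 c : i j / (i < j)%N >-> ~~ sim i j}}.
  by move/(pairwiseP x0); apply/negP.
have clashE l d : (l.+1 < size d)%N -> clash l d = sim (nth x0 d 0) (nth x0 d l.+1).
  by case: d => //= x d ld; congr sim; apply: set_nth_default.
move=> npw; case: (boolP [exists i : 'I_(k + k), [exists l : 'I_k, clash l (rot i c)]]).
  by case/existsP=> i /existsP[l h]; exists i, l.
move=> no; case: npw => i j; rewrite !inE sz => ilt jlt lt_ij.
apply/negP => sij; case/negP: no.
have [le_k|gt_k] := leqP (j - i) k.
  have lk : ((j - i).-1 < k)%N by lia.
  apply/existsP; exists (Ordinal ilt); apply/existsP; exists (Ordinal lk) => /=.
  rewrite clashE ?size_rot ?sz /rot ?nth_cat ?size_drop ?sz; last by lia.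
  rewrite !ifT ?nth_drop; [|lia..].
  by rewrite addn0 (_ : (i + (j - i).-1.+1)%N = j) //; lia.
have lk : ((i + (k + k) - j).-1 < k)%N by lia.
apply/existsP; exists (Ordinal jlt); apply/existsP; exists (Ordinal lk) => /=.
rewrite clashE ?size_rot ?sz /rot ?nth_cat ?size_drop ?sz; last by lia.
rewrite ifT ?ifF ?nth_drop ?nth_take; [|lia..].
by rewrite addn0 sim_sym (_ : ((i + (k + k) - j).-1.+1 - (k + k - j))%N = i) //; lia.
Qed.

Theorem exists_clash_free_cycle_ge k : (0 < k)%N -> (0 < #|V|)%N ->
  ((16 * k ^ 4 * s) ^ k * #|V| < delta ^ k)%N ->
  exists c : seq V, [/\ size c = (k + k)%N, path.cycle e c & pairwise (fun x y => ~~ sim x y) c].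
Proof.
case: k => // k _ V0 big.
pose good (c : seq V) := pairwise (fun x y => ~~ sim x y) c.
suff /seqsum_gt0[c sz] : 0 < seqsum (k.+1 + k.+1) (fun c => (good c)%:R * cyclew c).
  case gc: (good c); rewrite ?mul0r ?ltxx // mul1r => cw; exists c; split=> //.
  case: c cw {sz gc} => //= x c cw; apply: pathw_path; exact: lt0r_neq0.
rewrite ltNge; apply/negP => le0.
(* Union bound: each closed walk is either good or, by [clash_rot], counted by some rotation [i] and
   offset [l]. *)
have le1 : ret (k.+1 + k.+1) <= seqsum (k.+1 + k.+1) (fun c => (good c)%:R * cyclew c) +
   \sum_(i < k.+1 + k.+1) \sum_(l < k.+1)
     seqsum (k.+1 + k.+1) (fun c => (clash l (rot i c))%:R * cyclew c).
  rewrite -{1}[(k.+1 + k.+1)%N]/(k + k.+1).+1 -seqsum_cyclew.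
  under [X in _ <= _ + X]eq_bigr => i _ do rewrite -seqsum_sum.
  rewrite -seqsum_sum -seqsum_add; apply: ler_seqsum => c sz.
  have cw := cyclew_ge0 c.
  have S0 (i : 'I_(k.+1 + k.+1)) (l : 'I_k.+1) :
    0 <= (clash l (rot i c))%:R * cyclew c by rewrite mulr_ge0 ?ler0n.
  case gc: (good c); first by rewrite mul1r lerDl !sumr_ge0 // => i _; rewrite sumr_ge0.
  rewrite mul0r add0r.
  have [i [l h]] := @clash_rot k.+1 c sz (negbT gc).
  rewrite (bigD1 i) // (bigD1 l) //= h mul1r -addrA lerDl addr_ge0 //.
    by rewrite sumr_ge0.
  by rewrite sumr_ge0 // => j _; rewrite sumr_ge0.
(* With K = [k.+1], there are 2K^2 pairs [(i, l)], so this [C] makes the first terms of the bounds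
   add up to half of the trace. Absorbing that half doubles 2K^2 * C * s to 16K^4 * s. *)
pose C := (4 * k.+1 ^ 2)%N.
have C0 : (0 < C)%N by rewrite muln_gt0 expn_gt0.
have d0 : 0 < delta%:R :> F by rewrite ltr0n.
pose B := ret (k.+1 + k.+1) / C%:R + C%:R * s%:R / delta%:R * ret (k + k).
have le2 : ret (k.+1 + k.+1) <= (2 * k.+1 ^ 2)%N%:R * B.
  apply: le_trans le1 _; rewrite -[leRHS]add0r lerD //.
  have -> : (2 * k.+1 ^ 2)%N%:R * B = \sum_(i < k.+1 + k.+1) \sum_(l < k.+1) B.
    rewrite !sumr_const !card_ord -mulrnA mulr_natl; congr (_ *+ _); lia.
  apply: ler_sum => i _; apply: ler_sum => l _.
  apply: le_trans (clash_weight_le (ltn_ord l) C0).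
  rewrite -[leRHS](seqsum_rot i); apply: ler_seqsum => c _.
  by rewrite cyclew_rot.
have := @ret_geometric k ((16 * k.+1 ^ 4 * s)%N%:R / delta%:R) V0.
rewrite divr_ge0 ?ler0n // => /(_ isT) h; have {h}/h : 
  ret (k.+1 + k.+1) <= (16 * k.+1 ^ 4 * s)%N%:R / delta%:R * ret (k + k).
  suff E : (2 * k.+1 ^ 2)%N%:R * B = ret (k.+1 + k.+1) / 2 +
    (16 * k.+1 ^ 4 * s)%N%:R / delta%:R * ret (k + k) / 2 by lra.
  have K0 : (0 < k.+1 ^ 2)%N by rewrite expn_gt0.
  have -> : (k.+1 ^ 4 = k.+1 ^ 2 * k.+1 ^ 2)%N by rewrite -expnD.
  rewrite /B /C; move: (k.+1 ^ 2)%N K0 => K K0; rewrite !natrM; field.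
  by rewrite gt_eqF // gt_eqF // ltr0n.
rewrite expr_div_n mulrAC ler_pdivlMr ?exprn_gt0 // mul1r -!natrX -natrM ler_nat.
by rewrite leqNgt big.
Qed.
End ClosedWalks.

(** * From large average degree to large minimum degree *)

Section DegreeSum.
Variables (V : finType) (e : rel V).
Hypothesis e_sym : symmetric e.

(** A maximiser [S] of [f] works: deleting [x] costs at most twice its degree in [S] and gains
    [2 * d]. It is nonempty because the whole vertex set has a larger value of [f] than the empty
    set. *)
Lemma min_degree_subset d : 2 * d * #|V| < \sum_x deg e x ->
  exists2 S : {set V}, 0 < #|S| & {in S, forall x, d <= #|[pred y in S | e x y]|}.
Proof.
move=> big; pose E (S : {set V}) := \sum_(x in S) \sum_(y in S) e x y.
pose f (S : {set V}) := E S + 2 * d * (#|V| - #|S|).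
have [S _ maxS] := @arg_maxnP _ (set0 : {set V}) xpredT f isT.
have ES x : x \in S -> E S <= E (S :\ x) + 2 * #|[pred y in S | e x y]|.
  move=> xS; have dE : #|[pred y in S | e x y]| = \sum_(y in S) e x y.
    by rewrite -sum1_card -big_mkcondr.
  have s1 (g : V -> nat) : \sum_(y in S) g y = g x + \sum_(y in S :\ x) g y.
    rewrite (bigD1 x) //=; congr (_ + _); apply: eq_bigl => y.
    by rewrite !inE andbC.
  rewrite /E s1 -dE; under eq_bigr => y _ do rewrite s1.
  rewrite big_split /=.
  have : \sum_(y in S :\ x) e y x <= #|[pred y in S | e x y]|.
    rewrite dE s1; apply: leq_trans (leq_addl _ _).
    by apply: leq_sum => y _; rewrite e_sym.
  by move=> h; lia.
exists S => [|x xS].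
  have := maxS setT isT; rewrite /geq /= /f cardsT subnn muln0 addn0.
  have -> : E setT = \sum_x deg e x.
    apply: eq_big => [x|x _]; first by rewrite inE.
    rewrite /deg -sum1_card [RHS]big_mkcond; apply: eq_big => [y|y _]; first by rewrite inE.
    by rewrite inE; case: (e x y).
  rewrite card_gt0; case: eqP => // ->; rewrite /E big_set0 cards0 subn0 => h.
  by move: (leq_trans big h); rewrite ltnn.
have := maxS (S :\ x) isT; rewrite /geq /= /f.
have -> : #|V| - #|S :\ x| = (#|V| - #|S|).+1.
  by rewrite -subSn ?max_card // [#|S|](cardsD1 x) xS subSS.
by have := ES x xS; rewrite mulnS; lia.
Qed.

Lemma exists_clash_free_cycle (sim : rel V) (s k : nat) : symmetric sim ->
  (forall u v, #|[pred w | e v w && sim u w]| <= s) -> 0 < s -> 0 < k ->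
  (64 * k ^ 4 * s) ^ k * #|V| ^ k.+1 < (\sum_x deg e x) ^ k ->
  exists c : seq V,
    [/\ size c = k + k, path.cycle e c & pairwise (fun x y => ~~ sim x y) c].
Proof.
move=> sim_sym sim_nbr s0 k0; set E := \sum_x deg e x => big.
have V0 : 0 < #|V|.
  have [/card0_eq V0|//] := posnP #|V|; move: big; rewrite /E big1 ?exp0n //.
  by move=> x; have := V0 x.
have E4 : 4 * #|V| < E.
  rewrite -(ltn_exp2r _ _ k0); apply: leq_trans big.
  have : (4 * #|V|) ^ k <= (64 * k ^ 4 * s * #|V|) ^ k.
    rewrite leq_exp2r // leq_mul2r; apply/orP; right.
    have : 0 < k ^ 4 by rewrite expn_gt0 k0.
    by nia.
  by rewrite ltnS (expnSr #|V|) mulnA -expnMn => h; apply: leq_trans h (leq_pmulr _ V0).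
(* A quarter of the average degree, rounded up past it: [E4] leaves room for the added 1 in
   [2 * d * #|V| < E], and the factor 4 turns the constant 16 into 64. *)
pose d := (E %/ (4 * #|V|)).+1.
have dE : E < d * (4 * #|V|) by rewrite ltn_ceil // muln_gt0.
have [|S S0 minS] := @min_degree_subset d.
  have := leq_trunc_div E (4 * #|V|); rewrite /d -/E; nia.
have dk : (16 * k ^ 4 * s) ^ k * #|V| < d ^ k.
  rewrite -(ltn_pmul2r (_ : 0 < (4 * #|V|) ^ k)) ?expn_gt0 ?muln_gt0 ?V0 //.
  rewrite -expnMn; apply: leq_ltn_trans (_ : _ <= E ^ k) _; last by rewrite ltn_exp2r.
  apply: leq_trans (ltnW big); rewrite (expnS #|V|).
  rewrite (_ : 64 * k ^ 4 * s = 4 * (16 * k ^ 4 * s)); last by lia.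
  rewrite (expnMn 4 #|V|) (expnMn 4).
  by move: (_ ^ k) (4 ^ k) (#|V| ^ k) => x y z; nia.
pose U := {x | x \in S}.
have cU (P : pred V) : #|[pred y : U | P (val y)]| = #|[pred y in S | P y]|.
  rewrite -(card_image val_inj); apply: eq_card => y; rewrite !inE.
  apply/imageP/andP => [[z Pz ->]|[yS Py]]; first by split=> //; exact: valP.
  by exists (exist _ y yS).
have degU (x : U) : d <= deg (relpre val e : rel U) x.
  by rewrite /deg cU minS // (valP x).
(* The weights do not occur in the conclusion, so any ordered field serves; [rat] is taken. *)
have [|||||||c [sz ec pc]] := @exists_clash_free_cycle_ge rat U (relpre val e) _ _
  (relpre val sim) s d _ _ _ degU k k0.
- by move=> x y; exact: e_sym.
- by move=> x; apply: leq_trans (degU x).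
- by move=> x y; exact: sim_sym.
- move=> u v; rewrite (cU (fun y => e (val v) y && sim (val u) y)).
  apply: leq_trans (sim_nbr (val u) (val v)).
  by apply: subset_leq_card; apply/subsetP => y; rewrite !inE => /andP[].
- by [].
- by rewrite card_sig.
- apply: leq_ltn_trans dk; rewrite leq_mul2l; apply/orP; right.
  by rewrite card_sig max_card.
by exists (map val c); rewrite size_map cycle_map pairwise_map.
Qed.
End DegreeSum.

(** * The graph on injective tuples: clashes and number of edges *)

Section TupleGraph.
Variables (n c r : nat) (col : 'I_n -> 'I_n -> 'I_c).
Hypothesis col_proper : proper_colouring col.

Definition inj_tuple := {f : {ffun 'I_r -> 'I_n} | injectiveb f}.
Implicit Types f g h : inj_tuple.

(** The inequality of coordinates excludes the diagonal values of [col], which properness leaves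
    arbitrary. *)
Definition same_colours f g :=
  [exists a : 'I_c, [forall i, (val f i != val g i) && (col (val f i) (val g i) == a)]].
Definition meets f g := [exists i, [exists j, val f i == val g j]].

Lemma same_coloursP f g : reflect (exists a : 'I_c,
  forall i, val f i != val g i /\ col (val f i) (val g i) = a) (same_colours f g).
Proof.
apply: (iffP existsP) => -[a h]; exists a.
  by move=> i; have /forallP/(_ i)/andP[? /eqP] := h.
by apply/forallP => i; have [-> ->] := h i; rewrite eqxx.
Qed.

Lemma meetsP f g : reflect (exists i j, val f i = val g j) (meets f g).
Proof.
apply: (iffP existsP) => [[i /existsP[j /eqP h]]|[i [j h]]]; first by exists i, j.
by exists i; apply/existsP; exists j; rewrite h.
Qed.

Lemma same_colours_sym : symmetric same_colours.
Proof.
have [colC _] := col_proper.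
suff h f g : same_colours f g -> same_colours g f by move=> f g; apply/idP/idP; exact: h.
move=> /same_coloursP[a h]; apply/same_coloursP; exists a => i.
by have [ne <-] := h i; rewrite eq_sym colC.
Qed.

Lemma meets_sym : symmetric meets.
Proof.
suff h f g : meets f g -> meets g f by move=> f g; apply/idP/idP; exact: h.
by move=> /meetsP[i [j h]]; apply/meetsP; exists j, i.
Qed.

Lemma col_inj u v w : u != v -> u != w -> col u v = col u w -> v = w.
Proof.
move=> uv uw h; have [_ proper] := col_proper.
by apply/eqP; apply: contraLR (eqxx (col u v)) => vw; rewrite {2}h proper.
Qed.

(** Once the indices of the common vertex are fixed, one coordinate of [h] is known, hence the
    colour of its edge to [g], and by properness that colour determines all other coordinates. *)
Lemma meets_nbr f g : #|[pred h | same_colours g h && meets f h]| <= r ^ 2.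
Proof.
pose A i j := [pred h | same_colours g h && (val f i == val h j)].
have A1 i j : #|A i j| <= 1.
  apply/card_le1_eqP => h1 h2; rewrite !inE.
  move=> /andP[/same_coloursP[a1 E1] /eqP e1] /andP[/same_coloursP[a2 E2] /eqP e2].
  have a12 : a1 = a2.
    by have [_ <-] := E1 j; have [_ <-] := E2 j; rewrite -e1 -e2.
  apply/val_inj/ffunP => l; have [n1 c1] := E1 l; have [n2 c2] := E2 l.
  by apply: (col_inj n2 n1); rewrite c1 c2.
apply: leq_trans (_ : \sum_(p : 'I_r * 'I_r) #|A p.1 p.2| <= _); last first.
  have -> : r ^ 2 = \sum_(p : 'I_r * 'I_r) 1 by rewrite sum1_card card_prod card_ord mulnn.
  by apply: leq_sum => p _; exact: A1.
rewrite -sum1_card; under [leqRHS]eq_bigr => p _ do rewrite -sum1_card big_mkcond.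
rewrite exchange_big big_mkcond; apply: leq_sum => h _ /=; rewrite inE.
case: andP => // -[gh /meetsP[i [j E]]].
by rewrite (bigD1 (i, j)) //= inE gh E eqxx.
Qed.

(** Each colour class is a matching: [sees a] is the set it covers, and [partner a] maps a covered
    vertex to its mate and fixes the others. *)
Definition sees a := [set u | [exists v, (u != v) && (col u v == a)]].
Definition partner (a : 'I_c) u := odflt u [pick v | (u != v) && (col u v == a)].

Lemma partnerP a u : u \in sees a -> u != partner a u /\ col u (partner a u) = a.
Proof.
rewrite inE /partner => /existsP[v uv].
by case: pickP => [w /andP[uw /eqP]|/(_ v)] //=; rewrite uv.
Qed.

Lemma partner_inj a : {in sees a &, injective (partner a)}.
Proof.
move=> u v /partnerP[u1 u2] /partnerP[v1 v2] E.
have [colC _] := col_proper.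
apply: (@col_inj (partner a u)); first by rewrite eq_sym.
  by rewrite E eq_sym.
by rewrite colC u2 E colC v2.
Qed.

(** Double counting of pairs of a vertex and a colour seen there: the [n - 1] edges at a vertex have
    distinct colours. *)
Lemma sum_card_sees : n * n.-1 <= \sum_(a < c) #|sees a|.
Proof.
under eq_bigr => a _ do rewrite -sum1_card big_mkcond.
rewrite exchange_big /= -{1}(card_ord n) -sum_nat_const.
apply: leq_sum => u _.
have -> : n.-1 = #|[pred v | v != u]| by rewrite cardC1 card_ord.
rewrite -(@card_in_imset _ _ (col u)).
  rewrite -sum1_card big_mkcond; apply: leq_sum => a _.
  case: imsetP => // -[v]; rewrite inE => vu ->.
  by rewrite inE ifT //; apply/existsP; exists v; rewrite eq_sym vu eqxx.
by move=> v w; rewrite !inE => vu wu; apply: col_inj; rewrite eq_sym.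
Qed.

(** Moving all coordinates of [f] along their edges of colour [a] gives a neighbour, and its
    coordinate 0 recovers [a]. *)
Lemma deg_same_colours_ge f : 0 < r ->
  #|[set a | [forall i, val f i \in sees a]]| <= deg same_colours f.
Proof.
move=> r0; pose nb (a : 'I_c) : inj_tuple :=
  (* The default [f] is never reached for the colours counted, since [partner a] is injective on
     [sees a]. *)
  insubd f [ffun i => partner a (val f i)].
have nbE a : [forall i, val f i \in sees a] -> forall i, val (nb a) i = partner a (val f i).
  move/forallP => fa i; rewrite /nb val_insubd ifT ?ffunE //.
  apply/injectiveP => j l; rewrite !ffunE => /partner_inj E.
  by apply: (injectiveP _ (valP f)); exact: E.
rewrite -(@card_in_imset _ _ nb).
  apply: subset_leq_card; apply/subsetP => g /imsetP[a]; rewrite inE => fa ->.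
  rewrite inE; apply/same_coloursP; exists a => i; rewrite nbE //.
  by apply: partnerP; move/forallP: fa.
move=> a b; rewrite !inE => fa fb E.
have /partnerP[_ <-] := forallP fa (Ordinal r0).
by rewrite -nbE // E nbE //; have /partnerP[_ ->] := forallP fb (Ordinal r0).
Qed.

(** Exchanging the sums, colour [a] is counted once for every injective tuple inside [sees a]. *)
Lemma sum_deg_same_colours : 0 < r ->
  \sum_(a < c) #|sees a| ^_ r <= \sum_(f : inj_tuple) deg same_colours f.
Proof.
move=> r0.
apply: leq_trans (_ : \sum_(f : inj_tuple) #|[set a | [forall i, val f i \in sees a]]| <= _); last first.
  by apply: leq_sum => f _; exact: deg_same_colours_ge.
under [leqRHS]eq_bigr => f _ do rewrite -sum1_card big_mkcond.
rewrite exchange_big /=; apply: leq_sum => a _.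
rewrite -[X in _ ^_ X](card_ord r) -card_inj_ffuns_on -big_mkcond sum1_card.
rewrite -[leqRHS](card_image val_inj); apply: subset_leq_card; apply/subsetP => f.
rewrite inE => /andP[/ffun_onP fa fi]; apply/imageP.
exists (exist _ f fi) => //; rewrite unfold_in /=.
suff : a \in [set a0 | [forall i, f i \in sees a0]] by [].
by rewrite inE; apply/forallP.
Qed.

Lemma card_inj_tuple : #|{: inj_tuple}| <= n ^ r.
Proof.
by rewrite card_sig; apply: leq_trans (max_card _) _; rewrite card_ffun !card_ord.
Qed.

End TupleGraph.

(** * Convexity estimate for falling factorials *)

Lemma ffact_lower m j : 2 * j <= m -> m ^ j.+1 <= 2 ^ j * m ^_ j.+1.
Proof.
elim: j => [|j IH] jm; first by rewrite ffactn1 expn1 mul1n.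
have h1 : m ^ j.+1 <= 2 ^ j * m ^_ j.+1 by apply: IH; lia.
(* Every factor of the falling factorial is at least [m / 2]. *)
have h2 : m <= 2 * (m - j.+1) by lia.
rewrite (expnSr m j.+1) (expnSr 2) (ffactnSr m j.+1).
by apply: leq_trans (leq_mul h1 h2) _; rewrite mulnACA.
Qed.

(* The colour classes of size below half the average carry at most half of the
   total; on the others [m ^_ r] is comparable with [m ^ r]. *)
Lemma sum_ffact_lower c r M (m : 'I_c -> nat) : 0 < r -> 4 * r * c <= M ->
  M <= \sum_(a < c) m a -> M ^ r <= 2 * (4 * c) ^ r.-1 * \sum_(a < c) m a ^_ r.
Proof.
case: r => // r _ cM Mm /=; have [->|M0] := posnP M; first by rewrite exp0n.
have c0 : 0 < c.
  rewrite lt0n; apply/eqP => c0; move: M0; rewrite ltnNge; case/negP.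
  by apply: leq_trans Mm _; rewrite big1 // => -[a a_lt]; exfalso; rewrite c0 in a_lt.
have small : 2 * \sum_(a < c) (if 2 * c * m a < M then m a else 0) <= M.
  rewrite -(leq_pmul2r c0) mulnAC big_distrr /=.
  apply: leq_trans (_ : \sum_(a < c) M <= _); last by rewrite sum_nat_const card_ord mulnC.
  by apply: leq_sum => a _; case: ltnP => [/ltnW|]; lia.
have one a : m a * M ^ r <= (4 * c) ^ r * m a ^_ r.+1 +
    (if 2 * c * m a < M then m a else 0) * M ^ r.
  case: ltnP => [_|large]; first exact: leq_addl.
  rewrite mul0n addn0.
  have rm : 2 * r <= m a by nia.
  apply: leq_trans (_ : m a * (2 * c * m a) ^ r <= _).
    by apply: leq_mul => //; case: (posnP r) => [->|r0] //; rewrite leq_exp2r.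
  have -> : m a * (2 * c * m a) ^ r = (2 * c) ^ r * m a ^ r.+1.
    by rewrite (expnMn (2 * c)) (expnS (m a)) mulnCA.
  have -> : (4 * c) ^ r = (2 * c) ^ r * 2 ^ r by rewrite -expnMn; congr (_ ^ _); lia.
  by rewrite -mulnA leq_mul2l (ffact_lower rm) orbT.
have : (\sum_(a < c) m a) * M ^ r <= (4 * c) ^ r * (\sum_(a < c) m a ^_ r.+1) +
    (\sum_(a < c) if 2 * c * m a < M then m a else 0) * M ^ r.
  by rewrite !big_distrl big_distrr -big_split /=; apply: leq_sum => a _; exact: one.
have := leq_mul Mm (leqnn (M ^ r)); rewrite expnS.
move: small; set S := \sum_(a < c) (if _ then _ else _).
move: (\sum_(a < c) m a ^_ r.+1) ((4 * c) ^ r) (M ^ r) (\sum_(a < c) m a) => x y z w.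
by nia.
Qed.

(** * From a cycle of tuples to disjoint copies, and the final count *)

Lemma cycle_nthS (T : Type) (x0 : T) (e : rel T) (p : seq T) i :
  path.cycle e p -> i < size p -> e (nth x0 p i) (nth x0 p (i.+1 %% size p)).
Proof.
case: p => // x p /= /(pathP x0) h ip; have := h i; rewrite size_rcons => /(_ ip).
rewrite nth_rcons -rcons_cons nth_rcons /= ip.
have [lt_ip|le_pi] := ltnP i (size p); first by rewrite modn_small.
have -> : i = size p by lia.
by rewrite eqxx modnn.
Qed.

(** Copy [j] consists of the [j]-th coordinates along the cycle. Vertices at different positions
    differ because the tuples do not meet, those at the same position because tuples are injective;
    the identity automorphism matches the colours. *)
Lemma disjoint_copies_of_clash_free_cycle (n c r m : nat)
    (col : 'I_n -> 'I_n -> 'I_c) (p : seq (inj_tuple n r)) :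
  proper_colouring col -> 0 < m -> size p = m -> path.cycle (same_colours col) p ->
  pairwise (fun f g => ~~ meets f g) p ->
  has_r_disjoint_iso_copies r (@cycle_graph m) col.
Proof.
move=> [colC _] m0 sz ec; rewrite -{m}sz in m0 *.
have [x0 _] : exists x0 : inj_tuple n r, true by case: p m0 {ec} => // x; exists x.
move=> /(pairwiseP x0) apart.
pose F (j : 'I_r) (u : 'I_(size p)) := val (nth x0 p u) j.
have far (u v : 'I_(size p)) : u != v -> forall j j', F j u != F j' v.
  move=> uv j j'; apply/eqP => E.
  have [lt_uv|lt_vu|/val_inj] := ltngtP u v; last by move/eqP: uv.
    have /negP[] := apart u v (ltn_ord u) (ltn_ord v) lt_uv.
    by apply/meetsP; exists j, j'.
  have /negP[] := apart v u (ltn_ord v) (ltn_ord u) lt_vu.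
  by apply/meetsP; exists j', j.
have succ_col (u v : 'I_(size p)) j j' : val v = (val u).+1 %% size p ->
    col (F j u) (F j v) = col (F j' u) (F j' v).
  move=> E; have := cycle_nthS x0 ec (ltn_ord u); rewrite -E.
  by move=> /same_coloursP[a h]; rewrite /F (h j).2 (h j').2.
exists F; split; [|split].
- by move=> j u v; apply: contra_eq => uv; apply: far.
- move=> j j' jj' u v; have [<-|uv] := eqVneq u v; last exact: far.
  by apply: contra jj' => /eqP/(injectiveP _ (valP (nth x0 p u)))/eqP.
move=> j j' _; exists 1%g; split=> u v; rewrite !permE // => /orP[] /eqP E.
  exact: succ_col.
by rewrite colC [RHS]colC; exact: succ_col.
Qed.

(* The first two factors are lost when the edges of the graph on r-tuples are
   counted, the third is the constant of [exists_clash_free_cycle] for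
   [s = r ^ 2], and the last one forces [16 * r * c < n ^ 2]. *)
Definition threshold k r :=
  2 ^ (r.+1 * k) * 4 ^ (r.-1 * k) * (64 * k ^ 4 * r ^ 2) ^ k * (16 * r) ^ (r.-1 * k).

Lemma disjoint_copies (k r n c : nat) (col : 'I_n -> 'I_n -> 'I_c) :
  0 < k -> 1 < r -> 1 < n -> proper_colouring col ->
  threshold k r * c ^ (r.-1 * k) < n ^ (r * k.-1) ->
  has_r_disjoint_iso_copies r (@cycle_graph (2 * k)) col.
Proof.
move=> k0 r1 n1 pc few; have r0 : 0 < r by lia.
have L0 : 0 < r.-1 * k by rewrite muln_gt0; lia.
(* Compare powers of exponent [(r - 1) * k], using [r * (k - 1) <= 2 * (r - 1) * k]. This supplies
   the size condition of [sum_ffact_lower] for [n * (n - 1)]. *)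
have cn : 16 * r * c < n ^ 2.
  rewrite -(ltn_exp2r _ _ L0) expnMn; apply: leq_ltn_trans (_ : _ <= threshold k r * c ^ (r.-1 * k)) _.
    rewrite leq_mul2r /threshold leq_pmull ?orbT //.
    by rewrite !(muln_gt0, expn_gt0) k0 r0 ?orbT.
  apply: leq_trans few _; rewrite -expnM leq_pexp2l //; last by nia.
  exact: ltnW.
have n2 : n ^ 2 <= 2 * (n * n.-1) by nia.
set E := \sum_f deg (same_colours col (r := r)) f.
have EM : (n * n.-1) ^ r <= 2 * (4 * c) ^ r.-1 * E.
  apply: leq_trans (sum_ffact_lower r0 _ (sum_card_sees pc)) _; first by lia.
  by rewrite leq_mul2l sum_deg_same_colours ?orbT.
have nE : n ^ (2 * r * k) <= 2 ^ (r.+1 * k) * 4 ^ (r.-1 * k) * c ^ (r.-1 * k) * E ^ k.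
  rewrite (expnM n) (expnM n) (expnM 2) (expnM 4) (expnM c) -!expnMn leq_exp2r //.
  apply: leq_trans (_ : (2 * (n * n.-1)) ^ r <= _); first by rewrite leq_exp2r.
  rewrite expnMn; apply: leq_trans (leq_mul (leqnn (2 ^ r)) EM) _.
  by rewrite (expnS 2) (expnMn 4); nia.
have E0 : 0 < E ^ k.
  rewrite lt0n; apply/eqP => E0; move: nE; rewrite E0 muln0 leqn0 expn_eq0.
  by case: n n1 {col pc few cn n2 E EM E0}.
have big : (64 * k ^ 4 * r ^ 2) ^ k * #|{: inj_tuple n r}| ^ k.+1 < E ^ k.
  (* The factor [n ^ (r * k.-1)] completes the bound [n ^ (r * k.+1)] on the tuples to
     [n ^ (2 * r * k)], to which [nE] applies; [few] then finishes. *)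
  rewrite -(ltn_pmul2l (_ : 0 < n ^ (r * k.-1))) ?expn_gt0 ?(ltnW n1) //.
  apply: leq_ltn_trans (_ : (64 * k ^ 4 * r ^ 2) ^ k * n ^ (2 * r * k) < _).
    have -> : 2 * r * k = r * k.-1 + r * k.+1.
      by rewrite -mulnDr mulnAC mulnC; congr (_ * _); lia.
    rewrite mulnCA leq_mul2l.
    rewrite expnD leq_mul2l (expnM n r k.+1) leq_exp2r // card_inj_tuple.
    by rewrite !orbT.
  apply: leq_ltn_trans (leq_mul (leqnn _) nE) _.
  rewrite mulnA ltn_pmul2r //; apply: leq_ltn_trans few.
  rewrite /threshold.
  have : 0 < (16 * r) ^ (r.-1 * k) by rewrite expn_gt0 muln_gt0 r0.
  move: (_ ^ _) (_ ^ _) (_ ^ _) (_ ^ _) (_ ^ _).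
  by move=> x1 x2 x3 x4 x5; nia.
have [|p [sz ec pw]] := exists_clash_free_cycle (same_colours_sym pc)
  (@meets_sym n r) (meets_nbr pc) _ k0 big.
- by rewrite expn_gt0 r0.
by rewrite mul2n -addnn; apply: disjoint_copies_of_clash_free_cycle pc _ sz ec pw; rewrite addn_gt0 k0.
Qed.

Theorem theorem1p11 (k r : nat) : 2 <= k -> 2 <= r ->
  exists eps : R, Rlt 0 eps /\
  exists N : nat, forall n : nat, N <= n ->
    forall (c : nat) (col : 'I_n -> 'I_n -> 'I_c),
      proper_colouring col ->
      Rlt (INR c) (Rmult eps (Rpower (INR n) (expo r k))) ->
      has_r_disjoint_iso_copies r (@cycle_graph (2 * k)) col.
Proof.
move=> k2 r2; have k0 : 0 < k by lia.
have Q0 : 0 < threshold k r.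
  by rewrite !(muln_gt0, expn_gt0) k0 (ltnW r2) ?orbT.
have [eps eps0 few_colours] := lt_expn_of_lt_Rpower_expo Q0 r2 k0.
exists eps; split=> //; exists 2 => n n2 c col pc few.
by apply: disjoint_copies pc _ => //; apply: few_colours few; exact: ltnW.
Qed.
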